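(* Let $\mathbf{W}\in\mathbb{R}^{m\times n}$ be a full-precision weight matrix, let $Q(\mathbf{W})\in\mathbb{R}^{m\times n}$ be its quantized counterpart, and let $\mathbf{E}:=\mathbf{W}-Q(\mathbf{W})\in\mathbb{R}^{m\times n}$ be the quantization error matrix. The objective function $f(X)=\left\|\mathbf{E}-X\right\|_F^2$ is convex and $L$-smooth with $L=2$, where $X\in\mathbb{R}^{m\times n}$ is a rank-$r$ matrix.
   Context: $\|\cdot\|_F$ denotes the Frobenius norm on $\mathbb{R}^{m\times n}$. $Q$ is a quantization map sending a real matrix to a real matrix of the same size. The variable $X$ stands for a low-rank product $X=L_1L_2$ with $L_1\in\mathbb{R}^{m\times r}$ and $L_2\in\mathbb{R}^{r\times n}$, where typically $r\ll\min(m,n)$. Convex means $f(\lambda X_1+(1-\lambda)X_2)\le\lambda f(X_1)+(1-\lambda)f(X_2)$ for $\lambda\in[0,1]$. $L$-smooth means that the gradient is $L$-Lipschitz in the Frobenius norm: $\|\nabla f(X_1)-\nabla f(X_2)\|_F\le L\,\|X_1-X_2\|_F$. *)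

(* Defs.v *)
From mathcomp Require Import all_boot all_order all_algebra.
From mathcomp Require Import all_classical all_reals all_analysis.

Set Implicit Arguments.
Unset Strict Implicit.
Unset Printing Implicit Defensive.

Import Order.TTheory GRing.Theory Num.Theory.
Import numFieldNormedType.Exports.

Local Open Scope classical_set_scope.
Local Open Scope ring_scope.

(* The norm `|A| that the library puts on matrices is the max norm. *)
Definition frobenius_norm (R : realType) (m n : nat) (A : 'M[R]_(m, n)) : R :=
  Num.sqrt (\sum_(i < m) \sum_(j < n) A i j ^+ 2).

(* Meaningful at the points where f is differentiable; there it represents
   'd f X for the Frobenius inner product \sum_i \sum_j A i j * B i j. *)
Definition gradient (R : realType) (m n : nat) (f : 'M[R]_(m, n) -> R)
    (X : 'M[R]_(m, n)) : 'M[R]_(m, n) :=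
  \matrix_(i < m, j < n) 'D_(delta_mx i j) f X.

(* Differentiability and the gradient are those of f on the whole space
   'M[R]_(m, n), also when D has empty interior. *)
Definition L_smooth (R : realType) (m n : nat) (D : set 'M[R]_(m, n))
    (L : R) (f : 'M[R]_(m, n) -> R) : Prop :=
  {in D, forall X, differentiable f X} /\
  {in D &, forall X1 X2, frobenius_norm (gradient f X1 - gradient f X2)
                         <= L * frobenius_norm (X1 - X2)}.

(* Products L1 L2 with inner dimension r, that is, the matrices of rank at
   most r; those of rank exactly r are among them. *)
Definition low_rank (R : realType) (m n r : nat) : set 'M[R]_(m, n) :=
  [set X | exists (L1 : 'M[R]_(m, r)) (L2 : 'M[R]_(r, n)), X = L1 *m L2].
Arguments low_rank : clear implicits.

(* Main.v *)
Require Import Defs.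
From mathcomp Require Import all_boot all_order all_algebra.
From mathcomp Require Import all_classical all_reals all_analysis.
From mathcomp Require Import ring.

Set Implicit Arguments.
Unset Strict Implicit.
Unset Printing Implicit Defensive.

Import Order.TTheory GRing.Theory Num.Theory.
Import numFieldNormedType.Exports.

Local Open Scope classical_set_scope.
Local Open Scope ring_scope.

(** The squared norm is a sum over the entries of the one-variable quadratics
    [(E i j - X i j) ^+ 2], so both claims reduce to entrywise computations. Convexity: the gap in
    the inequality is, at each entry, s(1-s) times a square ([convex_frobenius_norm_sqr_sub]).
    Smoothness: the gradient is the affine map 2(X - E) ([gradient_frobenius_norm_sqr_sub]), so
    differences of gradients are exactly twice differences of points. Both lemmas leave the domain
    [D] arbitrary, so they serve the whole space and [low_rank] alike. *)

Lemma frobenius_norm_sqr (R : realType) (m n : nat) (A : 'M[R]_(m, n)) :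
  frobenius_norm A ^+ 2 = \sum_(i < m) \sum_(j < n) A i j ^+ 2.
Proof.
rewrite sqr_sqrtr //; apply: sumr_ge0 => i _; apply: sumr_ge0 => j _.
exact: sqr_ge0.
Qed.

Lemma frobenius_normZ (R : realType) (m n : nat) (a : R) (A : 'M[R]_(m, n)) :
  frobenius_norm (a *: A) = `|a| * frobenius_norm A.
Proof.
rewrite /frobenius_norm -sqrtr_sqr -sqrtrM ?sqr_ge0 //; congr Num.sqrt.
rewrite mulr_sumr; apply: eq_bigr => i _.
by rewrite mulr_sumr; apply: eq_bigr => j _; rewrite mxE exprMn.
Qed.

(** Derivatives of matrix-valued maps are taken entrywise, so this is the (i, j) entry of the
    derivative of the identity along [V]. *)
Lemma is_derive_coord (R : realType) (m n : nat) (i : 'I_m) (j : 'I_n)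
    (X V : 'M[R]_(m, n)) :
  is_derive X V (fun Y : 'M[R]_(m, n) => Y i j : R) (V i j).
Proof.
apply: DeriveDef; first exact: diff_derivable (differentiable_coord _ _ _).
have := derive_mx (@derivable_id _ _ X V); rewrite derive_id => /matrixP/(_ i j).
by rewrite mxE => <-.
Qed.

(** Recasts the objective as a sum in the ring of functions, the form to which the differentiation
    rules for sums, powers and differences apply. *)
Lemma frobenius_norm_sqr_subE (R : realType) (m n : nat) (E : 'M[R]_(m, n)) :
  (fun X : 'M[R]_(m, n) => frobenius_norm (E - X) ^+ 2) =
  \sum_(i < m) \sum_(j < n)
    (cst (E i j) - (fun X : 'M[R]_(m, n) => X i j : R)) ^+ 2.
Proof.
apply/funext => X; rewrite frobenius_norm_sqr fct_sumE.
apply: eq_bigr => i _; rewrite fct_sumE; apply: eq_bigr => j _.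
by rewrite fctE /= !mxE.
Qed.

Lemma differentiable_frobenius_norm_sqr_sub (R : realType) (m n : nat)
    (E X : 'M[R]_(m, n)) :
  differentiable (fun Y : 'M[R]_(m, n) => frobenius_norm (E - Y) ^+ 2) X.
Proof.
rewrite frobenius_norm_sqr_subE.
apply: differentiable_sum => i; apply: differentiable_sum => j.
apply: differentiableX; apply: differentiableB; first exact: differentiable_cst.
exact: differentiable_coord.
Qed.

Lemma gradient_frobenius_norm_sqr_sub (R : realType) (m n : nat)
    (E X : 'M[R]_(m, n)) :
  gradient (fun Y : 'M[R]_(m, n) => frobenius_norm (E - Y) ^+ 2) X =
  2 *: (X - E).
Proof.
apply/matrixP => k l; rewrite !mxE frobenius_norm_sqr_subE.
(* Left unsimplified to match what the power and difference rules produce: exponent 2 - 1, and 0 for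
   the derivative of the constant. *)
pose d i j : R := (2%:R * (E i j - X i j) ^+ 1) *: (0 - delta_mx k l i j).
have D : is_derive X (delta_mx k l) (\sum_(i < m) \sum_(j < n)
    (cst (E i j) - (fun Y : 'M[R]_(m, n) => Y i j : R)) ^+ 2)
    (\sum_(i < m) \sum_(j < n) d i j).
  apply: is_derive_sum => i; apply: is_derive_sum => j.
  by apply: is_deriveX; apply: is_deriveB; exact: is_derive_coord.
(* Only the entry (k, l) varies along [delta_mx k l], so every other term of the double sum
   vanishes. *)
rewrite derive_val (bigD1 k) //= (bigD1 l) //= !big1 => [||j /negPf jl].
- by rewrite /d mxE !eqxx /GRing.scale /= !addr0; ring.
- move=> i /negPf ik; apply: big1 => j _.
  by rewrite /d mxE ik subr0 scaler0.
- by rewrite /d mxE jl andbF subr0 scaler0.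
Qed.

Lemma convex_frobenius_norm_sqr_sub (R : realType) (m n : nat)
    (D : set 'M[R]_(m, n)) (E : 'M[R]_(m, n)) :
  convex_function D (fun X : 'M[R]_(m, n) => frobenius_norm (E - X) ^+ 2).
Proof.
move=> t X Y _ _; rewrite convRE !frobenius_norm_sqr.
rewrite !mulr_sumr -big_split /=.
apply: ler_sum => i _; rewrite !mulr_sumr -big_split /=.
apply: ler_sum => j _; rewrite !mxE /unstable.onem.
set s := t%:num; rewrite -subr_ge0.
(* With a, b the two residuals: s a^2 + (1-s) b^2 - (s a + (1-s) b)^2 = s(1-s)(a-b)^2, and [E i j]
   cancels in a - b. *)
have -> : s * (E i j - X i j) ^+ 2 + (1 - s) * (E i j - Y i j) ^+ 2 -
    (E i j - (s * X i j + (1 - s) * Y i j)) ^+ 2 =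
    s * (1 - s) * (X i j - Y i j) ^+ 2 by ring.
apply: mulr_ge0; last exact: sqr_ge0.
by apply: mulr_ge0; rewrite ?subr_ge0 /s; [exact: ge0|exact: le1].
Qed.

Lemma L_smooth_frobenius_norm_sqr_sub (R : realType) (m n : nat)
    (D : set 'M[R]_(m, n)) (E : 'M[R]_(m, n)) :
  L_smooth D 2 (fun X : 'M[R]_(m, n) => frobenius_norm (E - X) ^+ 2).
Proof.
split=> [X _|X1 X2 _ _]; first exact: differentiable_frobenius_norm_sqr_sub.
(* [E] cancels in the difference of gradients, so the Lipschitz bound holds with equality at
   constant 2. *)
rewrite !gradient_frobenius_norm_sqr_sub -scalerBr frobenius_normZ ger0_norm //.
by rewrite opprB addrA subrK.
Qed.

Theorem mainTheorem1 (R : realType) (m n r : nat)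
    (Q : 'M[R]_(m, n) -> 'M[R]_(m, n)) (W : 'M[R]_(m, n)) :
  let E := W - Q W in
  let f := fun X : 'M[R]_(m, n) => frobenius_norm (E - X) ^+ 2 in
  (convex_function [set: 'M[R]_(m, n)] f /\
   L_smooth [set: 'M[R]_(m, n)] 2 f) /\
  (convex_function (low_rank R m n r) f /\
   L_smooth (low_rank R m n r) 2 f).
Proof.
move=> E f; split; split.
- exact: convex_frobenius_norm_sqr_sub.
- exact: L_smooth_frobenius_norm_sqr_sub.
- exact: convex_frobenius_norm_sqr_sub.
- exact: L_smooth_frobenius_norm_sqr_sub.
Qed.
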